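(* Let $T_0$ be an orientation preserving diffeomorphism of the circle $\mathbb{S}^1$ with irrational rotation number $\alpha$ and such that $\log(T_0')$ has bounded variation, and let $\mu_0$ be its unique invariant Borel probability measure. For each integer $N\ge1$ let $T_N=P_N\circ T_0$ be the $N$-discretization of $T_0$, and suppose $\mu_N$ is an invariant Borel probability measure of $T_N$. Then $$\lim_{N\to\infty}\int_{\mathbb{S}^1}f\,d\mu_N=\int_{\mathbb{S}^1}f\,d\mu_0\qquad\text{for all }f\in C^0(\mathbb{S}^1).$$
   Context: $\mathbb{S}^1=\mathbb{R}/\mathbb{Z}$. For $N\ge1$, $P_N:\mathbb{S}^1\to\mathbb{S}^1$ is the projection onto the uniform grid $E_N=\{\frac iN\in\mathbb{R}/\mathbb{Z}:1\le i\le N\}$ given by $P_N(x)=\frac{\lfloor Nx\rfloor}{N}$, where $\lfloor\cdot\rfloor$ is the floor function (this is well defined modulo $\mathbb{Z}$). A measure $\mu$ is invariant for a Borel map $T$ if $\mu(T^{-1}(A))=\mu(A)$ for all Borel sets $A$. *)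

(* Defs.v *)
From HB Require Import structures.
From mathcomp Require Export all_boot all_order all_algebra ring_quotient.
From mathcomp Require Export all_classical all_reals all_analysis.

Set Implicit Arguments.
Unset Strict Implicit.
Unset Printing Implicit Defensive.

Export Order.TTheory GRing.Theory Num.Theory.
Export numFieldNormedType.Exports.

Local Open Scope classical_set_scope.
Local Open Scope quotient_scope.
Local Open Scope ring_scope.

(* The circle is the quotient group R / Z with the quotient topology and the
   Borel sigma-algebra of that topology. *)
Definition circle (R : realType) : Type :=
  quotient_topology (@Quotient.quot R (@Num.int_num_subdef R : {pred R})).

HB.instance Definition _ (R : realType) := Quotient.on (circle R).
HB.instance Definition _ (R : realType) := PointedTopological.on (circle R).

Definition circle_display (R : realType) : measure_display :=
  sigma_display (@open (circle R)).

HB.instance Definition _ (R : realType) :=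
  @isMeasurable.Build (circle_display R) (circle R) <<s @open (circle R) >>
    (@sigma_algebra0 _ setT _) (@sigma_algebraC _ _)
    (@sigma_algebra_bigcup _ setT _).

Definition circle_pi (R : realType) (x : R) : circle R := \pi_(circle R) x.

Lemma circle_piP (R : realType) (x y : R) :
  circle_pi x = circle_pi y <-> x - y \is a Num.int.
Proof.
have := @Quotient.idealrBE R (@Num.int_num_subdef R : {pred R}) x y.
rewrite -[X in X = _]/(x - y \is a Num.int) => ->.
by split => [xy|/eqP//]; apply/eqP.
Qed.

Section CircleMaps.
Context {R : realType}.
Implicit Types (T S : circle R -> circle R) (F : R -> R).

Definition is_lift T F : Prop :=
  continuous F /\ forall x, T (circle_pi x) = circle_pi (F x).

(* Two lifts of T differ by an integer constant, so dT does not depend on F. *)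
Definition is_circle_derivative T (dT : circle R -> R) : Prop :=
  exists2 F, is_lift T F & forall x : R, is_derive x 1 F (dT (circle_pi x)).

Definition circle_C1 T : Prop :=
  exists2 dT, is_circle_derivative T dT & continuous dT.

Definition circle_diffeomorphism T : Prop :=
  circle_C1 T /\ exists S, [/\ cancel T S, cancel S T & circle_C1 S].

Definition orientation_preserving T : Prop :=
  exists2 F, is_lift T F & {homo F : x y / x < y}.

(* The translation number of a lift, taken modulo Z; changing the lift changes
   rho by an integer. *)
Definition is_rotation_number T (alpha : circle R) : Prop :=
  exists2 F, is_lift T F &
    exists2 rho : R,
      forall x, (iter n F x - x) / n%:R @[n --> \oo] --> rho &
      alpha = circle_pi rho.

Definition irrational_angle (alpha : circle R) : Prop :=
  forall a : R, alpha = circle_pi a -> irrational a.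

Definition circle_bounded_variation (g : circle R -> R) : Prop :=
  bounded_variation 0 1 (g \o @circle_pi R).

(* [repr] picks an arbitrary real representative; see [grid_projE]. *)
Definition grid_proj (N : nat) (p : circle R) : circle R :=
  circle_pi ((Num.floor (N%:R * repr p))%:~R / N%:R).

Definition discretization (N : nat) T : circle R -> circle R :=
  grid_proj N \o T.

Lemma grid_projE (N : nat) (x : R) : (0 < N)%N ->
  grid_proj N (circle_pi x) = circle_pi ((Num.floor (N%:R * x))%:~R / N%:R).
Proof.
move=> N0; have NR0 : N%:R != 0 :> R by rewrite pnatr_eq0 -lt0n.
have /circle_piP/intrP[k rk] :
    circle_pi (repr (circle_pi x)) = circle_pi x by exact: reprK.
apply/circle_piP; have -> : repr (circle_pi x) = x + k%:~R.
  by rewrite -rk addrC subrK.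
rewrite mulrDr -mulrBl.
have -> : N%:R * k%:~R = (N%:Z * k)%:~R :> R by rewrite intrM.
rewrite floorDrz ?intr_int// intrKfloor intrD addrAC subrr add0r intrM.
by rewrite mulrAC divff// mul1r intr_int.
Qed.

Definition invariant_measure T
    (mu : probability (circle R) R) : Prop :=
  forall A : set (circle R), measurable A -> mu (T @^-1` A) = mu A.

End CircleMaps.

(* Main.v *)
Require Import Defs.
From mathcomp Require Import measurable_realfun zify ring lra.

(* Let F be the lift of T0 with translation number rho, and let
   d rho - p > 0 be small.  For c <= y <= F^d c - p, the distances between
   F^k y and F^k c, k < n, add up to at most
     sum_(k < n) (F^(k + d) c - p - F^k c) <= n (d rho - p) + d,
   by telescoping and |F^n z - z - n rho| <= 1.  So the Birkhoff averages of a
   continuous function nearly agree at y and at c.  The orbit of x under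
   F^d - p passes, within a bounded number of steps, just below any given y in
   [x, x + 1[, and moving the base point along its orbit hardly changes long
   averages: the Birkhoff averages of f thus become uniformly close to
   constants.  Finally the defect of T0-invariance of mu_N on a fixed continuous
   function tends to 0, because T_N is 1/N-close to T0; hence the integrals of f
   against mu_N and mu_0 are both close to those constants. *)

Set Implicit Arguments.
Unset Strict Implicit.

Local Open Scope classical_set_scope.
Local Open Scope ring_scope.

(** Adding the first n and the first d terms of [u] to either side gives the sum of its first n + d
    terms. *)
Lemma sumr_shift_diff (R : zmodType) (u : nat -> R) (n d : nat) :
  \sum_(k < n) (u (k + d)%N - u k) = \sum_(i < d) (u (i + n)%N - u i).
Proof.
rewrite !sumrB; apply/eqP; rewrite subr_eq addrAC eq_sym subr_eq eq_sym.
have H m e : \sum_(k < m) u (k + e)%N + \sum_(k < e) u k = \sum_(k < m + e) u k.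
  rewrite addrC addnC big_split_ord /=; congr (_ + _).
  by apply: eq_bigr => i _; rewrite addnC.
by rewrite !H addnC.
Qed.

(** * Small positive values of d rho - p for irrational rho *)

Section IrrationalRotation.
Context {R : realType} (rho : R).
Hypothesis rho_irr : irrational rho.

Lemma irrational_rotation_neq0 (d : nat) (p : int) :
  (0 < d)%N -> d%:R * rho - p%:~R != 0.
Proof.
move=> d0; apply/eqP => /subr0_eq E; apply: rho_irr.
have d0' : d%:R != 0 :> R by rewrite pnatr_eq0 -lt0n.
exists (p%:Q / d%:Q) => //.
by rewrite fmorph_div /= !ratr_int -E mulrC mulKf.
Qed.

Lemma floor_inv_bounds (t : R) : 0 < t < 1 ->
  exists2 k : nat, (0 < k)%N & k%:R * t <= 1 < k.+1%:R * t.
Proof.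
move=> /andP[t0 t1]; have it1 : 1 < t^-1 by rewrite invf_gt1.
exists (Num.truncn t^-1); first by rewrite truncn_gt0 ltW.
have := truncn_itv (ltW (lt_trans ltr01 it1)) => /andP[].
by rewrite -[_%:R <= _](ler_pM2r t0) -[_ < _%:R](ltr_pM2r t0) mulVf ?gt_eqF// => -> ->.
Qed.

(** A Euclidean step: 1 lies between the consecutive multiples k t and (k + 1) t, and its distances
    to them add up to t, so one of them is at most t / 2. *)
Lemma irrational_rotation_halve (d : nat) (p : int) :
  (0 < d)%N -> 0 < d%:R * rho - p%:~R < 1 ->
  exists (d' : nat) (p' : int), (0 < d')%N /\
    0 < d'%:R * rho - p'%:~R <= (d%:R * rho - p%:~R) / 2.
Proof.
move=> d0; set t := _ - _ => t01; have [k k0 /andP[k1 k2]] := floor_inv_bounds t01.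
have [t1|t2] := leP (k.+1%:R * t - 1) (t / 2).
  exists (k.+1 * d)%N, (k.+1%:Z * p + 1); split; first by rewrite muln_gt0.
  have -> : (k.+1 * d)%:R * rho - (k.+1%:Z * p + 1)%:~R = k.+1%:R * t - 1.
    by rewrite /t natrM intrD intrM /=; ring.
  by rewrite t1 subr_gt0 k2.
(* The short gap [s] is the negative of a value of d rho - p. To restore the sign, the largest
   multiple m s below 1 is taken: 1 - m s has the right form, is smaller than [s], and is nonzero by
   irrationality. *)
set s := 1 - k%:R * t.
have ds : s = - ((k * d)%:R * rho - (k%:Z * p + 1)%:~R).
  by rewrite /s /t natrM intrD intrM /=; ring.
have s0 : s != 0 by rewrite ds oppr_eq0 irrational_rotation_neq0// muln_gt0 k0.
have s01 : 0 < s < 1.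
  rewrite lt_def s0 /= subr_ge0 k1/= /s.
  have : 0 < k%:R * t by rewrite mulr_gt0 ?ltr0n//; case/andP: t01.
  lra.
have st : s < t / 2 by move: t2; rewrite -(@natr1 R k) /s; lra.
have [m m0 /andP[m1 m2]] := floor_inv_bounds s01.
exists (m * (k * d))%N, (m%:Z * (k%:Z * p + 1) - 1).
rewrite !muln_gt0 m0 k0 d0; split=> //.
have E : (m * (k * d))%:R * rho - (m%:Z * (k%:Z * p + 1) - 1)%:~R = 1 - m%:R * s.
  by rewrite ds natrM intrD intrM /=; ring.
rewrite lt_def irrational_rotation_neq0 ?muln_gt0 ?m0 ?k0// E subr_ge0 m1 /=.
by move: m2; rewrite -(@natr1 R m); lra.
Qed.

Lemma irrational_rotation_small (e : R) : 0 < e ->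
  exists (d : nat) (p : int), (0 < d)%N /\ 0 < d%:R * rho - p%:~R < e.
Proof.
move=> e0.
have H n : exists (d : nat) (p : int), (0 < d)%N /\
    0 < d%:R * rho - p%:~R < 1 /\ (2 ^ n)%:R * (d%:R * rho - p%:~R) <= 1.
  elim: n => [|n [d [p [d0 [t01 tn]]]]].
    exists 1%N, (Num.floor rho); split => //.
    have := floorD1_gt rho; have := floor_le rho; rewrite intrD => h1 h2.
    have := @irrational_rotation_neq0 1 (Num.floor rho) isT => h3.
    rewrite lt_def h3 expn0 mulr1n !mul1r; split; lra.
  have [d' [p' [d'0 /andP[h1 h2]]]] := irrational_rotation_halve d0 t01.
  exists d', p'; split => //; rewrite h1.
  set t := _ - _ in t01 tn h2; set t' := _ - _ in h1 h2 *.
  split; first lra.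
  rewrite expnS natrM; apply: le_trans tn.
  have : (2^n)%:R * t' <= (2^n)%:R * (t / 2) :> R by apply: ler_wpM2l.
  lra.
(* With n > 1 / e, the bound 2 ^ n > n makes the n-th halved value less than e. *)
have [d [p [d0 [/andP[t0 _] tn]]]] := H (Num.bound e^-1).
exists d, p; rewrite d0 t0; split=> //=.
set t := _ - _ in t0 tn *; set n := Num.bound _ in tn.
have en : e^-1 < n%:R by apply: archi_boundP; rewrite invr_ge0 ltW.
have e2 : 1 < (2 ^ n)%:R * e.
  rewrite -ltr_pdivrMr// div1r (lt_trans en)// ltr_nat; exact: ltn_expl.
have n20 : 0 < (2 ^ n)%:R :> R by rewrite ltr0n expn_gt0.
by rewrite -(ltr_pM2l n20) (le_lt_trans tn).
Qed.
End IrrationalRotation.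

(** * Monotone degree-one maps: displacements, orbits and Birkhoff sums *)

Section DegreeOneMap.
Context {R : realType} (F : R -> R).
Hypothesis F_mono : {homo F : x y / x <= y}.
Hypothesis F_add1 : forall x, F (x + 1) = F x + 1.

Lemma iter_lift_homo n : {homo iter n F : x y / x <= y}.
Proof. by elim: n => //= n IH x y /IH/F_mono. Qed.

Lemma lift_addz x (k : int) : F (x + k%:~R) = F x + k%:~R.
Proof.
have H (m : nat) y : F (y + m%:R) = F y + m%:R.
  by elim: m y => [|m IH] y; rewrite ?addr0// -natr1 addrA F_add1 IH addrA.
case: k => m; first exact: H.
rewrite NegzE mulrNz; apply/eqP; rewrite -subr_eq opprK; apply/eqP.
by rewrite -H subrK.
Qed.

Lemma iter_lift_addz n x (k : int) : iter n F (x + k%:~R) = iter n F x + k%:~R.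
Proof. by elim: n => //= n ->; exact: lift_addz. Qed.

(** Displacement is 1-periodic, so y may be replaced by its translate z with z <= x <= z + 1;
    monotonicity then gives F^n z - z <= F^n x - z <= F^n x - x + 1. *)
Lemma displacement_osc n x y :
  iter n F y - y <= iter n F x - x + 1.
Proof.
pose z := y - (Num.floor (y - x))%:~R - 1.
have zx : z <= x.
  have := floorD1_gt (y - x); rewrite intrD /z; lra.
have yz : y = z + (Num.floor (y - x) + 1)%:~R by rewrite intrD /z; lra.
have zx' : x <= z + 1.
  have := floor_le (y - x); rewrite /z; lra.
have := iter_lift_homo n zx; rewrite yz iter_lift_addz; lra.
Qed.

Context (rho : R).
Hypothesis F_rho : forall x, (iter n F x - x) / n%:R @[n --> \oo] --> rho.

(** Each of the k blocks of n iterates has a displacement within 1 of the one starting at x. *)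
Lemma displacement_iter_mul n x k :
  `|iter (k * n) F x - x - k%:R * (iter n F x - x)| <= k%:R.
Proof.
elim: k => [|k IH]; first by rewrite mul0r subrr subr0 normr0.
rewrite mulSn iterD -natr1.
set y := iter (k * n) F x in IH *.
have := displacement_osc n x y; have := displacement_osc n y x.
move: IH; rewrite !ler_norml; nra.
Qed.


(** Divide [displacement_iter_mul] by k and let k tend to infinity: the mean displacement along
    multiples of n still tends to rho. *)
Lemma displacement_rho n x : `|iter n F x - x - n%:R * rho| <= 1.
Proof.
case: n => [|n]; first by rewrite mul0r subrr subr0 normr0.
have sub : (iter (k * n.+1) F x - x) / (k * n.+1)%:R @[k --> \oo] --> rho.
  apply: (cvg_comp (fun k => k * n.+1)%N _ _ (F_rho x)) => A [N _ NA].
  by exists N => // k /= Nk; apply: NA => /=; rewrite (leq_trans Nk)// leq_pmulr.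
have lim : `|iter n.+1 F x - x - n.+1%:R * ((iter (k * n.+1) F x - x) / (k * n.+1)%:R)|
    @[k --> \oo] --> `|iter n.+1 F x - x - n.+1%:R * rho|.
  by apply: cvg_norm; apply: cvgB; [exact: cvg_cst|apply: cvgMr].
apply: (cvgr_to_le lim).
near=> k.
have k0 : 0 < k%:R :> R by rewrite ltr0n; near: k; exact: nbhs_infty_gt.
have := displacement_iter_mul n.+1 x k.
rewrite natrM; set a := iter (k * _) _ _; set b := iter _ _ _ => H.
have E : (b - x - n.+1%:R * ((a - x) / (k%:R * n.+1%:R))) * k%:R =
    - (a - x - k%:R * (b - x)).
  have : n.+1%:R != 0 :> R by rewrite pnatr_eq0.
  by move: n.+1%:R => N N0; field; rewrite N0 gt_eqF.
by rewrite -(ler_pM2r k0) mul1r -[X in _ * X <= _](gtr0_norm k0) -normrM E normrN.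
Unshelve. all: by end_near. Qed.

Lemma sum_iter_gap_le (n d : nat) (p : int) c y :
  c <= y <= iter d F c - p%:~R ->
  \sum_(k < n) (iter k F y - iter k F c) <= n%:R * (d%:R * rho - p%:~R) + d%:R.
Proof.
move=> /andP[cy yd].
apply: (@le_trans _ _ (\sum_(k < n) ((iter (k + d) F c - iter k F c) - p%:~R))).
  apply: ler_sum => k _; rewrite iterD addrAC lerD2r.
  by rewrite (le_trans (iter_lift_homo k yd))// -mulrNz iter_lift_addz// mulrNz.
rewrite sumrB (sumr_shift_diff (fun k => iter k F c)) sumr_const card_ord.
rewrite -[in X in _ - X]mulr_natl.
(* After the exchange of n and d, the error 1 of [displacement_rho] is paid d times instead of n
   times. *)
have : \sum_(i < d) (iter (i + n) F c - iter i F c) <= \sum_(i < d) (n%:R * rho + 1).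
  apply: ler_sum => i _; rewrite addnC iterD.
  by have := displacement_rho n (iter i F c); rewrite ler_norml => /andP[_]; lra.
rewrite sumr_const card_ord -mulr_natl; lra.
Qed.

Lemma orbit_bracket (d J : nat) (p : int) x y :
  2 <= J%:R * (d%:R * rho - p%:~R) -> x <= y < x + 1 ->
  exists2 j, (j < J)%N &
    iter (j * d) F x - (j%:Z * p)%:~R <= y
      <= iter d F (iter (j * d) F x - (j%:Z * p)%:~R) - p%:~R.
Proof.
move=> J2 /andP[xy yx].
(* After J steps of F^d - p the point x has advanced by at least 2 - 1 = 1, hence beyond y. The
   first passage beyond y is step j + 1, so step j is the last one before it. *)
have PJ : y < iter (J * d) F x - (J%:Z * p)%:~R.
  have := displacement_rho (J * d) x.
  by rewrite ler_norml => /andP[+ _]; rewrite natrM intrM /=; nra.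
have exP : exists j, y < iter (j * d) F x - (j%:Z * p)%:~R by exists J.
case: (ex_minnP exP) => -[|j] Pj minj.
  by move: Pj; rewrite mul0n /= mul0r subr0 => /lt_geF; rewrite xy.
exists j; first exact: minj.
apply/andP; split.
  by rewrite leNgt; apply/negP => /minj; rewrite ltnn.
rewrite -mulrNz iter_lift_addz// -iterD -mulSn mulrNz.
have E : j.+1%:Z * p = j%:Z * p + p by lia.
by move: Pj; rewrite E intrD; lra.
Qed.

Context (Phi : R -> R) (B : R).
Hypothesis Phi_per : forall x (k : int), Phi (x + k%:~R) = Phi x.
Hypothesis Phi_bnd : forall x, `|Phi x| <= B.

Let birkhoff n x := \sum_(k < n) Phi (iter k F x).

Lemma birkhoff_addz n x (k : int) : birkhoff n (x + k%:~R) = birkhoff n x.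
Proof. by apply: eq_bigr => i _; rewrite iter_lift_addz. Qed.

(** All but m terms at each end cancel. *)
Lemma birkhoff_iter n m x :
  `|birkhoff n (iter m F x) - birkhoff n x| <= m%:R * (2 * B).
Proof.
rewrite /birkhoff -sumrB.
rewrite (eq_bigr (fun k : 'I_n => Phi (iter (k + m) F x) - Phi (iter k F x))); last first.
  by move=> i _; rewrite iterD.
rewrite (sumr_shift_diff (fun k => Phi (iter k F x))).
apply: (le_trans (ler_norm_sum _ _ _)).
rewrite mulr_natl -[X in _ *+ X]card_ord -sumr_const; apply: ler_sum => i _.
apply: (le_trans (ler_normB _ _)).
by have := Phi_bnd (iter (i + n) F x); have := Phi_bnd (iter i F x); lra.
Qed.

Hypothesis rho_irr : irrational rho.
(** Uniform continuity in affine form: the linear term can be summed along two orbits and is then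
    controlled by their total gap. *)
Hypothesis Phi_mod : forall e, 0 < e ->
  exists2 C, 0 <= C & forall u v, `|Phi u - Phi v| <= e + C * `|u - v|.

Lemma birkhoff_sum_osc e : 0 < e ->
  exists2 n, (0 < n)%N & forall x y, `|birkhoff n y - birkhoff n x| <= n%:R * e.
Proof.
move=> e0; have e3 : 0 < e / 3 by rewrite divr_gt0.
have [C C0 PhiC] := Phi_mod e3.
(* The denominator is C + 1 because C may be 0. *)
have e3C : 0 < e / 3 / (C + 1) by rewrite divr_gt0// ltr_wpDl.
have [d [p [d0]]] := irrational_rotation_small rho_irr e3C.
set t := d%:R * rho - p%:~R => /andP[t0 te].
have CT : C * t <= e / 3.
  by move: te; rewrite ltr_pdivlMr ?ltr_wpDl// mulrDr mulr1 mulrC; lra.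
pose J := Num.bound (2 / t).
have J2 : 2 <= J%:R * t.
  by rewrite -ler_pdivrMr// ltW// archi_boundP// divr_ge0// ltW.
have B0 : 0 <= B by apply: le_trans (Phi_bnd 0); exact: normr_ge0.
(* [K] collects the errors independent of n; n is then taken so large that they cost at most n e /
   3. *)
pose K := C * d%:R + (J * d)%:R * (2 * B).
have K0 : 0 <= K by rewrite addr_ge0// ?mulr_ge0.
pose n := (Num.bound (K / (e / 3))).+1.
have Kn : K <= n%:R * (e / 3).
  rewrite -ler_pdivrMr// ltW//.
  have /archi_boundP h : 0 <= K / (e / 3) by rewrite divr_ge0// ltW.
  by rewrite (lt_trans h)// ltr_nat.
exists n => // x y0.
(* An integer translation brings the point into [x, x + 1[ without changing its Birkhoff sum. *)
pose y := y0 + (- Num.floor (y0 - x))%:~R.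
rewrite -(birkhoff_addz n y0 (- Num.floor (y0 - x))) -/y.
have xy : x <= y < x + 1.
  have := floorD1_gt (y0 - x); have := floor_le (y0 - x).
  by rewrite /y intrD mulrNz => h1 h2; apply/andP; split; lra.
have [j jJ] := orbit_bracket J2 xy.
set c := _ - _ => cy.
have h1 : `|birkhoff n c - birkhoff n x| <= (J * d)%:R * (2 * B).
  rewrite /c -mulrNz birkhoff_addz (le_trans (birkhoff_iter _ _ _))//.
  by apply: ler_wpM2r; rewrite ?mulr_ge0// ler_nat leq_mul2r (ltnW jJ) orbT.
have h2 : `|birkhoff n y - birkhoff n c| <= n%:R * (e / 3) + C * (n%:R * t + d%:R).
  rewrite /birkhoff -sumrB (le_trans (ler_norm_sum _ _ _))//.
  apply: (@le_trans _ _ (\sum_(k < n) (e / 3 + C * (iter k F y - iter k F c)))).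
    apply: ler_sum => k _; rewrite (le_trans (PhiC _ _))// ger0_norm// subr_ge0.
    by apply: iter_lift_homo => //; case/andP: cy.
  rewrite big_split /= sumr_const card_ord mulr_natl lerD2l -mulr_sumr.
  by apply: ler_wpM2l => //; exact: sum_iter_gap_le.
have -> : birkhoff n y - birkhoff n x =
  (birkhoff n y - birkhoff n c) + (birkhoff n c - birkhoff n x) by ring.
rewrite (le_trans (ler_normD _ _))//.
have h3 : n%:R * (C * t) <= n%:R * (e / 3) by apply: ler_wpM2l.
move: Kn; rewrite /K; lra.
Qed.
End DegreeOneMap.

(** * Boundedness and uniform continuity of continuous periodic functions *)

Section PeriodicFunctions.
Context {R : realType} (Phi : R -> R).
Hypothesis Phi_cont : continuous Phi.
Hypothesis Phi_per : forall (x : R) (k : int), Phi (x + k%:~R) = Phi x.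

Lemma periodic_bounded : exists B, forall x, `|Phi x| <= B.
Proof.
have [|c _ Hc] := @EVT_max R (fun x => `|Phi x|) 0 1 ler01.
  by apply: continuous_subspaceT => x; apply: cvg_norm; exact: Phi_cont.
exists `|Phi c| => x; rewrite -(Phi_per x (- Num.floor x)); apply: Hc.
rewrite in_itv /= intrN.
by have := floorD1_gt x; have := floor_le x; rewrite intrD => h1 h2; apply/andP; split; lra.
Qed.

Lemma periodic_unif_continuous (e : R) : 0 < e ->
  exists2 d, 0 < d & forall u v, `|u - v| < d -> `|Phi u - Phi v| < e.
Proof.
move=> e0; have e2 : 0 < e / 2 by rewrite divr_gt0.
have /compact_near_coveringP cpt := @segment_compact R 0 1.
(* Compactness of [0, 1] is applied to u alone, with v ranging over the whole line; a translation by
   the floor of u thus covers all pairs. *)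
have := cpt R (0^'+)%R (fun d u => forall v, `|u - v| < d -> `|Phi u - Phi v| < e) _.
case=> [x _|].
  have /cvgrPdist_lt/(_ _ e2)/nbhs_ballP[r /= r0 xr] := @Phi_cont x.
  exists (ball x (r / 2), [set d | d < r / 2]) => /=.
    split; first by apply: nbhsx_ballx; rewrite divr_gt0.
    by apply: nbhs_right_lt; rewrite divr_gt0.
  move=> [u d] [/= xu dr] v uv.
  have h1 : `|Phi x - Phi u| < e / 2 by apply: xr; apply: le_ball xu; lra.
  have h2 : `|Phi x - Phi v| < e / 2.
    apply: xr; apply: (le_lt_trans (ler_distD u x v)).
    by rewrite [r]splitr ltrD// (lt_trans uv).
  apply: (le_lt_trans (ler_distD (Phi x) _ _)).
  by rewrite [e]splitr ltrD// distrC.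
move=> r /= r0 H; exists (r / 2); first by rewrite divr_gt0.
move=> u v uv.
rewrite -(Phi_per u (- Num.floor u)) -(Phi_per v (- Num.floor u)).
apply: (H (r / 2)) => /=.
- by rewrite /ball /= sub0r normrN gtr0_norm ?divr_gt0//; lra.
- by rewrite divr_gt0.
- rewrite in_itv /= intrN.
  by have := floorD1_gt u; have := floor_le u; rewrite intrD => h1 h2; apply/andP; split; lra.
- by rewrite opprD addrACA subrr addr0.
Qed.

(** Points closer than the uniform-continuity radius d are handled by e; for the others the trivial
    bound 2 B is at most (2 B / d) |u - v|. *)
Lemma periodic_modulus (e : R) : 0 < e ->
  exists2 C, 0 <= C & forall u v, `|Phi u - Phi v| <= e + C * `|u - v|.
Proof.
move=> e0; have [d d0 dP] := periodic_unif_continuous e0.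
have [B PhiB] := periodic_bounded.
have B0 : 0 <= B by apply: le_trans (PhiB 0); exact: normr_ge0.
exists (2 * B / d); first by rewrite divr_ge0 ?mulr_ge0// ltW.
move=> u v; have [uv|uv] := ltP `|u - v| d.
  apply: (le_trans (ltW (dP _ _ uv))).
  by rewrite lerDl mulr_ge0// divr_ge0 ?mulr_ge0// ltW.
have h : 2 * B <= 2 * B / d * `|u - v|.
  by rewrite mulrAC ler_pdivlMr// ler_wpM2l// mulr_ge0.
apply: (le_trans (ler_normB _ _)).
by have := PhiB u; have := PhiB v; lra.
Qed.
End PeriodicFunctions.

(** * Lifts of circle maps *)

Section Lifts.
Context {R : realType}.
Implicit Types (T : circle R -> circle R) (F G : R -> R).

(** Two distinct integer values would force, by the intermediate value theorem, a half-integer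
    value. *)
Lemma continuous_int_valued_cst (g : R -> R) : continuous g ->
  (forall x, g x \is a Num.int) -> forall x y, g x = g y.
Proof.
move=> gc gint.
suff H x y : x <= y -> g x = g y.
  by move=> x y; have [/H//|/ltW/H//] := leP x y.
move=> xy; apply: contrapT => gxy.
have /intrP[k Ek] := gint x; have /intrP[l El] := gint y.
pose m := Num.min k l.
have [||c _ gc'] := @IVT R g x y (m%:~R + 2^-1) xy.
- exact: continuous_subspaceT.
- have kl : k <> l by move=> kl; apply: gxy; rewrite Ek El kl.
  have h : (m + 1)%:~R <= Num.max (g x) (g y).
    by rewrite Ek El le_max !ler_int /m; lia.
  have h' : Num.min (g x) (g y) <= m%:~R.
    by rewrite Ek El ge_min !ler_int /m; lia.
  by move: h; rewrite intrD => h; apply/andP; split; lra.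
have /intrP[n En] := gint c.
have : (2 * n)%:~R = (2 * m + 1)%:~R :> R.
  by rewrite intrD !intrM -En gc'; field.
by move/eqP; rewrite eqr_int; lia.
Qed.

Lemma circle_pi_addz (x : R) (k : int) : circle_pi (x + k%:~R) = circle_pi x.
Proof. by apply/circle_piP; rewrite addrAC subrr add0r intr_int. Qed.

Lemma lifts_differ_int T F G : is_lift T F -> is_lift T G ->
  exists k : int, forall x, F x = G x + k%:~R.
Proof.
move=> [Fc TF] [Gc TG].
have FG x : F x - G x \is a Num.int by apply/circle_piP; rewrite -TF -TG.
have /intrP[k Ek] := FG 0; exists k => x.
have /(_ _ x 0) := continuous_int_valued_cst _ FG.
rewrite Ek => <-; first by rewrite addrC subrK.
by move=> y; apply: cvgB; [exact: Fc|exact: Gc].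
Qed.

(** F (x + 1) - F x is a constant positive integer. The value F 0 + 1 is attained at some c in
    [0, 1]; injectivity of T makes c an integer, and c = 0 is impossible, so c = 1. *)
Lemma increasing_lift_add1 T F : injective T -> is_lift T F ->
  {homo F : x y / x < y} -> forall x, F (x + 1) = F x + 1.
Proof.
move=> Tinj [Fc TF] Finc.
have Fint x : F (x + 1) - F x \is a Num.int.
  by apply/circle_piP; rewrite -!TF (circle_pi_addz x 1).
have Fcst x : F (x + 1) - F x = F 1 - F 0.
  rewrite -[1 in RHS]add0r.
  apply: (continuous_int_valued_cst (g := fun x => F (x + 1) - F x)) => // y.
  apply: cvgB; last exact: Fc.
  apply: (cvg_comp (fun z => z + 1) F) (Fc _).
  by apply: cvgD; [exact: cvg_id|exact: cvg_cst].
suff F01 : F 1 - F 0 = 1.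
  by move=> x; have := Fcst x; rewrite F01 => /eqP; rewrite subr_eq => /eqP ->; exact: addrC.
have /intrP[m Em] := Fint 0; rewrite add0r in Em.
have F0lt1 : F 0 < F 1 by exact: Finc.
have m0 : 0 < m by rewrite -(ltr0z R) -Em subr_gt0.
have m1' : 1 <= F 1 - F 0 by rewrite Em ler1z; lia.
have [||c] := @IVT R F 0 1 (F 0 + 1) ler01.
- exact: continuous_subspaceT.
- by rewrite min_l ?max_r ?(ltW F0lt1)//; apply/andP; split; lra.
rewrite in_itv /= => /andP[c0 c1] Fc1.
have /circle_piP/intrP[k] : circle_pi c = circle_pi (0 : R).
  by apply: Tinj; rewrite !TF Fc1 (circle_pi_addz _ 1).
rewrite subr0 => ck.
have [k0|k1] : k = 0 \/ k = 1.
  by move: c0 c1; rewrite ck ler0z lerz1; lia.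
- by move: Fc1; rewrite ck k0 => /eqP; rewrite -subr_eq0 opprD addNKr oppr_eq0 oner_eq0.
- by move: Fc1; rewrite ck k1 => ->; rewrite addrAC subrr add0r.
Qed.
End Lifts.

(** * Borel structure of the circle and integration of continuous functions *)

Section CircleMeasurability.
Context {R : realType}.

(** The preimage of the image is the union of the integer translates of A. *)
Lemma open_circle_pi_image (A : set R) : open A -> open (@circle_pi R @` A).
Proof.
move=> oA; rewrite /open /= /quotient_open.
have -> : \pi_(circle R)%qT @^-1` (@circle_pi R @` A) =
    \bigcup_(k in [set: int]) [set x | A (x + k%:~R)].
  apply/seteqP; split => [x /= [y Ay /circle_piP/intrP[k yx]]|x [k _ Ak]].
    by exists k => //=; rewrite -yx addrC subrK.
  by exists (x + k%:~R) => //; exact: circle_pi_addz.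
apply: bigcup_open => k _.
apply: (open_comp (f := fun x : R => x + k%:~R)) oA => x _.
by apply: cvgD; [exact: cvg_id|exact: cvg_cst].
Qed.

Lemma open_circle_measurable (A : set (circle R)) : open A -> measurable A.
Proof. exact: sub_sigma_algebra. Qed.

Lemma circle_pi_co_measurable (a b : R) : measurable (@circle_pi R @` `[a, b[).
Proof.
have [ab|ba] := ltP a b; last first.
  by rewrite set_itv_ge ?image_set0 // bnd_simp -leNgt.
rewrite -(@setU1itv _ _ _ _ false)// image_setU image_set1; apply: measurableU.
  rewrite -[X in measurable X]setCK; apply: measurableC; apply: open_circle_measurable.
  (* The arc splits into its left endpoint and an open arc; the endpoint is closed, its complement
     being the image of an open interval of length 1. *)
  have -> : ~` [set circle_pi a] = @circle_pi R @` `]a, a + 1[.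
    apply/seteqP; split => [p /= pa|_ [x + <-] /= /circle_piP/intrP[k xa]].
      have [x px] : exists x, p = circle_pi x by exists (repr p); rewrite -[LHS]reprK.
      exists (x + (- Num.floor (x - a))%:~R); last by rewrite circle_pi_addz.
      rewrite /= in_itv /= intrN; have := floorD1_gt (x - a); have := floor_le (x - a).
      rewrite intrD => h1 h2; apply/andP; split; last by lra.
      suff : (Num.floor (x - a))%:~R != x - a by move/eqP => h3; lra.
      apply: contra_notN pa => /eqP E; rewrite px; apply/circle_piP.
      by rewrite -E intr_int.
    have -> : x = a + k%:~R by rewrite -xa addrC subrK.
    by rewrite /= in_itv /= ltrDl ltrD2l ltr0z ltrz1; lia.
  exact/open_circle_pi_image/interval_open.
by apply: open_circle_measurable; apply: open_circle_pi_image; exact: interval_open.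
Qed.

(** The projection is constant on each arc [i/N, (i + 1)/N[, so every preimage is a countable union
    of such arcs. Letting i run over all integers repeats arcs, harmlessly. *)
Lemma grid_proj_measurable (N : nat) : (0 < N)%N ->
  measurable_fun setT (@grid_proj R N).
Proof.
move=> N0 _ A _; rewrite setTI.
have NR : 0 < N%:R :> R by rewrite ltr0n.
have -> : @grid_proj R N @^-1` A =
    \bigcup_(i in [set i : int | A (circle_pi (i%:~R / N%:R))])
      (@circle_pi R @` `[i%:~R / N%:R, (i + 1)%:~R / N%:R[).
  apply/seteqP; split => [p /= Ap|_ /= [i Ai [x + <-]]].
    exists (Num.floor (N%:R * repr p)) => //.
    exists (repr p); last exact: reprK.
    by rewrite /= in_itv /= ler_pdivrMr// ltr_pdivlMr// mulrC floor_le floorD1_gt.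
  rewrite /= in_itv /= ler_pdivrMr// ltr_pdivlMr// mulrC => /floor_def ix.
  by rewrite grid_projE// ix.
rewrite bigcup_mkcond; apply: countable_bigcupT_measurable => // i.
by case: ifP => _ //; exact: circle_pi_co_measurable.
Qed.

Lemma continuous_circle_measurable_fun (f : circle R -> R) :
  continuous f -> measurable_fun setT f.
Proof.
move=> /continuousP cf; apply: (measurability _ (RGenOpens.measurableE R)).
move=> _ [_ [a [b ->] <-]]; rewrite setTI; apply: open_circle_measurable.
exact/cf/interval_open.
Qed.

Lemma continuous_circle_measurable_map (T : circle R -> circle R) :
  continuous T -> measurable_fun setT T.
Proof.
move=> /continuousP cT; apply: (measurability (@open (circle R))) => //.
by move=> _ [A oA <-]; rewrite setTI; apply: open_circle_measurable; exact: cT.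
Qed.

Lemma is_lift_continuous (T : circle R -> circle R) F : is_lift T F -> continuous T.
Proof.
move=> [Fc TF]; apply/quotient_continuous.
have -> : T \o \pi_(circle R)%qT = @circle_pi R \o F by apply/funext => x; exact: TF.
by move=> x; apply: continuous_comp; [exact: Fc|exact: pi_continuous].
Qed.

Lemma circle_pi_continuous : continuous (@circle_pi R).
Proof. exact: pi_continuous. Qed.

Lemma circle_continuous_bounded (f : circle R -> R) : continuous f ->
  exists B, forall p, `|f p| <= B.
Proof.
move=> cf; have [||B HB] := @periodic_bounded R (f \o @circle_pi R).
- by move=> x; apply: continuous_comp; [exact: circle_pi_continuous|exact: cf].
- by move=> x k; rewrite /= circle_pi_addz.
- by exists B => p; rewrite -[p]reprK; exact: HB.
Qed.

Lemma circle_continuous_comp_integrable (mu : probability (circle R) R)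
    (f : circle R -> R) (T : circle R -> circle R) :
  continuous f -> measurable_fun setT T -> mu.-integrable setT (EFin \o (f \o T)).
Proof.
move=> cf mT; apply: measurable_bounded_integrable => //.
- by rewrite (le_lt_trans (probability_le1 _ _))// ltry.
- by apply: measurableT_comp => //; exact: continuous_circle_measurable_fun.
- have [B fB] := circle_continuous_bounded cf.
  by exists B; split; rewrite ?num_real// => M BM x _; apply: (le_trans (fB _)); exact: ltW.
Qed.

Lemma circle_continuous_integrable (mu : probability (circle R) R) (f : circle R -> R) :
  continuous f -> mu.-integrable setT (EFin \o f).
Proof. by move=> cf; exact: circle_continuous_comp_integrable (@measurable_id _ _ _). Qed.

Lemma Rintegral_invariant (mu : probability (circle R) R) (T : circle R -> circle R)
    (f : circle R -> R) :
  measurable_fun setT T -> invariant_measure T mu -> continuous f ->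
  \int[mu]_x f (T x) = \int[mu]_x f x.
Proof.
move=> mT inv cf; rewrite /Rintegral; congr fine.
rewrite -(@integral_pushforward _ _ _ _ R T mT mu setT (EFin \o f))//.
- by apply: eq_measure_integral => // A mA _; exact: inv.
- by apply/measurable_EFinP; exact: continuous_circle_measurable_fun.
- exact: circle_continuous_comp_integrable.
Qed.

Lemma Rintegral_le_cst (mu : probability (circle R) R) (f : circle R -> R) e :
  mu.-integrable setT (EFin \o f) -> (forall x, `|f x| <= e) ->
  `|\int[mu]_x f x| <= e.
Proof.
move=> intf fe; apply: (le_trans (le_normr_Rintegral _ intf)) => //.
rewrite -[leRHS]mulr1 -[X in _ * X]/(fine 1%E) -(probability_setT mu).
rewrite -Rintegral_cst//; apply: le_Rintegral => //.
- exact: (integrable_norm intf).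
- by apply: finite_measure_integrable_cst.
Qed.
End CircleMeasurability.

(** * Almost invariance of the measures of the discretizations *)

Section InvariantMeasures.
Context {R : realType}.
Implicit Types (T : circle R -> circle R) (f g : circle R -> R).

Lemma is_lift_iter T F n (x : R) : is_lift T F ->
  iter n T (circle_pi x) = circle_pi (iter n F x).
Proof. by move=> [_ TF]; elim: n => //= n ->. Qed.

Lemma iter_continuous T n : continuous T -> continuous (iter n T).
Proof.
move=> Tc; elim: n => [|n IH] p; first exact: cvg_id.
exact: continuous_comp (IH p) (Tc _).
Qed.

Lemma grid_proj_dist_lt N (x : R) : (0 < N)%N ->
  `|x - (Num.floor (N%:R * x))%:~R / N%:R| < N%:R^-1.
Proof.
move=> N0; have NR : 0 < N%:R :> R by rewrite ltr0n.
have := floorD1_gt (N%:R * x); have := floor_le (N%:R * x).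
set k := Num.floor _; rewrite intrD => h1 h2.
have -> : x - k%:~R / N%:R = (N%:R * x - k%:~R) / N%:R by field; rewrite gt_eqF.
rewrite normrM [X in _ * X]ger0_norm ?invr_ge0 ?ltW// -[ltRHS]mul1r ltr_pM2r ?invr_gt0//.
by rewrite ger0_norm; lra.
Qed.

Lemma discretization_measurable T N : continuous T -> (0 < N)%N ->
  measurable_fun setT (discretization N T).
Proof.
move=> Tc N0; apply: measurableT_comp; first exact: grid_proj_measurable.
exact: continuous_circle_measurable_map.
Qed.

Lemma discretization_Rintegral_sub_cvg T (mu : nat -> probability (circle R) R) g :
  continuous T -> continuous g ->
  (forall N, (1 <= N)%N -> invariant_measure (discretization N T) (mu N)) ->
  \int[mu N]_x g (T x) - \int[mu N]_x g x @[N --> \oo] --> (0 : R).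
Proof.
move=> Tc gc inv; apply/cvgrPdist_le => e e0.
have gpi : continuous (g \o @circle_pi R).
  by move=> x; apply: continuous_comp; [exact: circle_pi_continuous|exact: gc].
have [|d d0 gd] := periodic_unif_continuous gpi _ e0.
  by move=> x k; rewrite /= circle_pi_addz.
near=> N.
have N0 : (0 < N)%N by near: N; exact: nbhs_infty_gt.
have Nd : N%:R^-1 < d.
  have : d^-1 < N%:R by near: N; exact: nbhs_infty_gtr.
  by move=> h; rewrite -[d]invrK ltf_pV2// ?posrE ?invr_gt0// ltr0n.
have mT := discretization_measurable Tc N0.
have intgT : (mu N).-integrable setT (EFin \o (g \o T)).
  apply: circle_continuous_integrable => p.
  by apply: continuous_comp; [exact: Tc|exact: gc].
have intgTN : (mu N).-integrable setT (EFin \o (g \o discretization N T)).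
  exact: circle_continuous_comp_integrable.
(* Invariance under the discretization replaces g by its composition with T_N, leaving an integrand
   that compares g at T p and at its grid projection, less than 1/N apart. *)
rewrite sub0r normrN -(Rintegral_invariant mT (inv _ N0) gc) -RintegralB//.
apply: Rintegral_le_cst.
  exact: (integrableB measurableT intgT intgTN).
move=> p; have [y Ty] : exists y, T p = circle_pi y.
  by exists (repr (T p)); rewrite -[LHS]reprK.
rewrite /discretization /= Ty grid_projE//; apply/ltW/gd.
by apply: lt_trans Nd; exact: grid_proj_dist_lt.
Unshelve. all: by end_near. Qed.

Lemma Rintegral_sum_continuous (mu : probability (circle R) R) n
    (h : nat -> circle R -> R) : (forall k, continuous (h k)) ->
  \int[mu]_x (\sum_(k < n) h k x) = \sum_(k < n) \int[mu]_x h k x.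
Proof.
move=> hc; elim: n => [|n IH].
  under eq_Rintegral do rewrite big_ord0.
  by rewrite big_ord0 Rintegral_cst// mul0r.
under eq_Rintegral do rewrite big_ord_recr /=.
rewrite big_ord_recr /= RintegralD ?IH//; last exact: circle_continuous_integrable.
apply: circle_continuous_integrable.
by apply: continuous_big => //; exact: add_continuous.
Qed.
End InvariantMeasures.

(** * Convergence of the integrals *)

Unset Implicit Arguments.

Theorem corollary36 (R : realType)
  (T0 : circle R -> circle R) (alpha : circle R) (dT0 : circle R -> R)
  (T0_diffeo : circle_diffeomorphism T0)
  (T0_orient : orientation_preserving T0)
  (T0_rot : is_rotation_number T0 alpha)
  (alpha_irr : irrational_angle alpha)
  (T0_deriv : is_circle_derivative T0 dT0)
  (T0_logBV : circle_bounded_variation (fun p => ln (dT0 p)))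
  (mu0 : probability (circle R) R)
  (mu0_inv : invariant_measure T0 mu0)
  (mu : nat -> probability (circle R) R)
  (mu_inv : forall N : nat, (1 <= N)%N ->
     invariant_measure (discretization N T0) (mu N))
  (f : circle R -> R) (f_cont : continuous f) :
  (\int[mu N]_x f x) @[N --> \oo] --> \int[mu0]_x f x.
Proof.
have [_ [S [T0K _ _]]] := T0_diffeo.
have [F liftF [rho F_rho alphaE]] := T0_rot.
have [G liftG Ginc] := T0_orient.
(* The lift giving the rotation number and the increasing lift differ by an integer, so the former
   is increasing too. *)
have [j FG] := lifts_differ_int liftF liftG.
have Finc : {homo F : x y / x < y} by move=> x y xy; rewrite !FG ltrD2r Ginc.
have F_mono : {homo F : x y / x <= y}.
  by move=> x y; rewrite le_eqVlt => /predU1P[->//|/Finc/ltW].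
have F_add1 := increasing_lift_add1 (can_inj T0K) liftF Finc.
have rho_irr : irrational rho by exact: alpha_irr.
have T0c := is_lift_continuous liftF.
pose h k p := f (iter k T0 p).
have hc k : continuous (h k).
  by move=> p; apply: continuous_comp; [exact: iter_continuous|exact: f_cont].
have fpi : continuous (f \o @circle_pi R).
  by move=> x; apply: continuous_comp; [exact: circle_pi_continuous|exact: f_cont].
have fper x (k : int) : (f \o @circle_pi R) (x + k%:~R) = (f \o @circle_pi R) x.
  by rewrite /= circle_pi_addz.
have [B fB] := periodic_bounded fpi fper.
apply/cvgrPdist_le => e e0.
have e3 : 0 < e / 3 by rewrite divr_gt0.
have [n n0 osc] := birkhoff_sum_osc F_mono F_add1 F_rho fper fB rho_irr
  (periodic_modulus fpi fper) e3.
pose S_ p := \sum_(k < n) h k p.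
have S_c : continuous S_ by apply: continuous_big => //; exact: add_continuous.
have Sosc p q : `|S_ p - S_ q| <= n%:R * (e / 3).
  rewrite -[p]reprK -[q]reprK; apply: le_trans (osc (repr q) (repr p)).
  rewrite -!sumrB le_eqVlt; apply/orP; left; apply/eqP; congr `|_|.
  by apply: eq_bigr => k _; rewrite /h /= -!(is_lift_iter _ _ liftF).
pose p0 := circle_pi (0 : R).
have avg (m : probability (circle R) R) :
    `|\sum_(k < n) \int[m]_x h k x - S_ p0| <= n%:R * (e / 3).
  have iS : m.-integrable setT (EFin \o S_) by exact: circle_continuous_integrable.
  have ic : m.-integrable setT (EFin \o cst (S_ p0)).
    exact: finite_measure_integrable_cst.
  have <- : \int[m]_x cst (S_ p0) x = S_ p0.
    by rewrite Rintegral_cst//= [X in fine X](probability_setT m) mulr1.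
  rewrite -Rintegral_sum_continuous// -RintegralB//.
  apply: Rintegral_le_cst => [|p]; last exact: Sosc.
  exact: (integrableB measurableT iS ic).
have mu0h k : \int[mu0]_x h k x = \int[mu0]_x f x.
  elim: k => // k <-; rewrite -(@Rintegral_invariant _ mu0 T0 (h k))//.
    by apply: eq_Rintegral => p _; rewrite /h iterSr.
  exact: continuous_circle_measurable_map.
(* Since [h k.+1] is [h k] composed with T0, each induction step adds one invariance defect, that of
   the continuous function [h k]. *)
have muh k : \int[mu N]_x h k x - \int[mu N]_x f x @[N --> \oo] --> (0 : R).
  elim: k => [|k IH].
    by under eq_fun do rewrite subrr; exact: cvg_cst.
  rewrite [X in X @ _](_ : _ = fun N =>
      (\int[mu N]_x h k (T0 x) - \int[mu N]_x h k x) +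
      (\int[mu N]_x h k x - \int[mu N]_x f x)); last first.
    apply/funext => N; rewrite addrA subrK; congr (_ - _).
    by apply: eq_Rintegral => p _; rewrite /h iterSr.
  rewrite -[X in _ --> X]addr0; apply: cvgD IH.
  exact: discretization_Rintegral_sub_cvg.
have muS : \sum_(k < n) (\int[mu N]_x h k x - \int[mu N]_x f x) @[N --> \oo] --> (0 : R).
  rewrite [X in _ --> X](_ : _ = \sum_(k < n) (0 : R)); last by rewrite big1_eq.
  by apply: cvg_big => [|k _]; [exact: add_continuous|exact: muh].
have ne3 : 0 < n%:R * (e / 3) by rewrite mulr_gt0// ltr0n.
have sumc (c : R) : \sum_(k < n) c = n%:R * c by rewrite sumr_const card_ord mulr_natl.
have avg0 := avg mu0.
rewrite (eq_bigr (fun=> \int[mu0]_x f x)) ?sumc in avg0; last by move=> k _; exact: mu0h.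
near=> N.
have avgN := avg (mu N).
have : `|\sum_(k < n) (\int[mu N]_x h k x - \int[mu N]_x f x)| <= n%:R * (e / 3).
  by near: N; move/cvgr0Pnorm_le : muS; apply.
rewrite sumrB sumc.
move: avgN avg0; move: (\sum_(k < n) _) (\int[mu N]_x _) (\int[mu0]_x _) => a b c.
move=> avgN avg0 aN; have nR : 0 < n%:R :> R by rewrite ltr0n.
rewrite -(ler_pM2l nR) -[X in X * `|_|](gtr0_norm nR) -normrM mulrBr.
move: (n%:R * c) (n%:R * b) (S_ p0) avgN avg0 aN => nc nb s avgN avg0 aN.
(* With everything multiplied by n, three errors of n e / 3 remain: the mean against [mu0], the mean
   against [mu N], and the accumulated invariance defect. *)
have -> : nc - nb = (nc - s) - (a - s) + (a - nb) by ring.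
apply: (le_trans (ler_normD _ _)); move: (ler_normB (nc - s) (a - s)); lra.
Unshelve. all: by end_near. Qed.
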